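(* Let $a_n$ be the number of $\pi\in S_n$ avoiding both arrow patterns $(12;1\to 3)$ and $(1;1\to 1)$, with $a_0=1$. For $n\ge 1$, $a_n=\sum_{k=1}^{n-1}(a_k+a_{k-1})(a_{n-k}+a_{n-k-1})$.
   Context: Standard cycle form of $\sigma\in S_n$: product of disjoint cycles (fixed points included), each cycle starting with its largest element, cycles listed in increasing order of largest elements. The fundamental bijection $\theta:S_n\to S_n$ erases the parentheses of the standard cycle form to give a one-line permutation. For $\pi\in S_n$, $\hat\pi=\theta^{-1}(\pi)$. An arrow pattern $(\nu;H)$ of size $k$: a string $\nu=a_1\dots a_m$ of positive integers and a set $H$ of arrows $b\to c$, with all integers appearing forming $[k]$. $\pi\in S_n$ contains $(\nu;H)$ if there is $X=\{x_1<\dots<x_k\}\subseteq[n]$ with positions $t_1<\dots<t_m$ such that $\pi_{t_1}\cdots\pi_{t_m}=x_{a_1}\cdots x_{a_m}$ and $\hat\pi(x_b)=x_c$ for every arrow $b\to c\in H$; otherwise it avoids it. In particular $\pi$ avoids $(1;1\to1)$ iff $\hat\pi$ has no fixed points. *)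

(* Defs.v *)
From mathcomp Require Import all_boot perm.

Set Implicit Arguments.
Unset Strict Implicit.
Unset Printing Implicit Defensive.

(* Permutations of [n] are the elements of 'S_n, acting on 'I_n = {0,..,n-1}:
   the integer i of [n] is represented by the ordinal i - 1. *)

Section FundamentalBijection.

Variable n : nat.
Implicit Types (s p : 'S_n) (x y : 'I_n).

(* [enum 'I_n] is increasing, so the cycle maxima are listed increasingly. *)
Definition cycle_maxima s : seq 'I_n :=
  [seq x : 'I_n <- enum 'I_n | all (fun y : 'I_n => y <= x) (orbit s x)].

Definition std_cycle_form s : seq (seq 'I_n) :=
  [seq orbit s x | x <- cycle_maxima s].

Definition theta_word s : seq 'I_n := flatten (std_cycle_form s).

Lemma cycle_maximaP s y : exists2 x, x \in cycle_maxima s & y \in orbit s x.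
Proof.
have [x yx xmax] :=
  @arg_maxnP _ y (fun z => z \in orbit s y) (@nat_of_ord n) (in_orbit s y).
exists x; last by rewrite -fconnect_orbit (fconnect_sym perm_inj) fconnect_orbit.
rewrite mem_filter mem_enum andbT; apply/allP => z xz.
apply: xmax; rewrite -!fconnect_orbit in yx xz *.
exact: connect_trans yx xz.
Qed.

Lemma theta_word_uniq s : uniq (theta_word s).
Proof.
rewrite /theta_word /std_cycle_form.
have : {subset cycle_maxima s <= cycle_maxima s} by [].
have : uniq (cycle_maxima s) by rewrite filter_uniq ?enum_uniq.
elim: {1 2 4}(cycle_maxima s) => //= x xs IH /andP[xNxs uxs] sub.
rewrite cat_uniq orbit_uniq IH ?andbT //=; last first.
  by move=> z zxs; apply: sub; rewrite inE zxs orbT.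
apply/hasPn => y /flatten_mapP[z zxs yz]; apply/negP => yx.
have xz : fconnect s x z.
  rewrite -!fconnect_orbit in yz yx; apply: connect_trans yx _.
  by rewrite (fconnect_sym perm_inj).
have zx : fconnect s z x by rewrite (fconnect_sym perm_inj).
have := sub x; rewrite mem_head mem_filter => /(_ isT)/andP[/allP mx _].
have := sub z; rewrite inE zxs orbT mem_filter => /(_ isT)/andP[/allP mz _].
have /val_inj xE : val x = val z.
  by apply/eqP; rewrite eqn_leq mz ?mx // -fconnect_orbit.
by rewrite xE zxs in xNxs.
Qed.

Lemma size_theta_word s : size (theta_word s) = n.
Proof.
rewrite -[RHS](size_enum_ord n); apply/eqP.
rewrite -(uniq_size_uniq (enum_uniq _)) ?theta_word_uniq // => y.
rewrite mem_enum; apply/esym/flatten_mapP.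
by have [x] := cycle_maximaP s y; exists x.
Qed.

Definition theta_fun s (i : 'I_n) : 'I_n := nth i (theta_word s) i.

Lemma theta_fun_inj s : injective (theta_fun s).
Proof.
move=> i j; rewrite /theta_fun (set_nth_default j) ?size_theta_word // => /eqP.
by rewrite nth_uniq ?size_theta_word ?theta_word_uniq // => /eqP/val_inj.
Qed.

Definition theta s : 'S_n := perm (@theta_fun_inj s).

Lemma theta_word_inj : injective theta_word.
Proof.
have uniqueness (f g : 'I_n -> seq 'I_n) (xs ys : seq 'I_n) :
  sorted (fun x y => x < y) xs -> sorted (fun x y => x < y) ys ->
  (forall x, x \in xs -> all (fun y : 'I_n => y <= x) (f x)) ->
  (forall x, x \in ys -> all (fun y : 'I_n => y <= x) (g x)) ->
  flatten [seq x :: f x | x <- xs] = flatten [seq x :: g x | x <- ys] ->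
  forall x, x \in xs -> f x = g x.
- elim: xs ys => [|x xs IH] [|y ys] //= pxs pys fm gm [xy]; rewrite -{y}xy in pys gm *.
  have split (h : 'I_n -> seq 'I_n) zs :
     path (fun x y : 'I_n => x < y) x zs -> all (fun y : 'I_n => y <= x) (h x) ->
     find (fun y : 'I_n => x < y) (h x ++ flatten [seq x :: h x | x <- zs])
       = size (h x).
  + move=> pzs hx; rewrite find_cat ifF; last first.
      apply/negbTE/hasPn => y /(allP hx); by rewrite leqNgt.
    by case: zs pzs => [|z zs] /=; rewrite ?addn0 // => /andP[-> _]; rewrite addn0.
  move=> E; have Es : size (f x) = size (g x).
    by rewrite -(split f xs pxs) ?E ?split ?fm ?gm ?mem_head.
  move/eqP: E; rewrite eqseq_cat // => /andP[/eqP fg /eqP E] z.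
  rewrite inE => /predU1P[->//|]; apply: (IH ys) => //; try exact: path_sorted pxs.
  + exact: path_sorted pys.
  + by move=> u uxs; apply: fm; rewrite inE uxs orbT.
  + by move=> u uys; apply: gm; rewrite inE uys orbT.
have orbE s x : orbit s x = x :: behead (orbit s x).
  by rewrite /orbit -orderSpred.
have srt s : sorted (fun x y : 'I_n => x < y) (cycle_maxima s).
  apply: sorted_filter; first by move=> ? ? ?; apply: ltn_trans.
  rewrite -(@sorted_map _ _ val ltn) val_enum_ord; exact: iota_ltn_sorted.
have bnd s x : x \in cycle_maxima s ->
    all (fun y : 'I_n => y <= x) (behead (orbit s x)).
  by rewrite mem_filter {1}orbE /= leqnn => /andP[].
have wE s : theta_word s
    = flatten [seq x :: behead (orbit s x) | x <- cycle_maxima s].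
  by congr flatten; apply: eq_map => x; apply: orbE.
move=> s s' E; apply/permP => y; have [x xs yx] := cycle_maximaP s y.
have orbs : orbit s x = orbit s' x.
  rewrite orbE [RHS]orbE; congr cons; move: x xs {yx}.
  by apply: (uniqueness _ _ _ (cycle_maxima s')); rewrite -?wE //; apply: bnd.
have /eqP-> := next_cycle (cycle_orbit (@perm_inj _ s) x) yx.
rewrite orbs in yx *.
by have /eqP<- := next_cycle (cycle_orbit (@perm_inj _ s') x) yx.
Qed.

Lemma theta_inj : injective theta.
Proof.
move=> s s' /permP E; apply: theta_word_inj.
case: (posnP n) => [n0|n_gt0].
  by rewrite (size0nil (etrans (size_theta_word s) n0))
             (size0nil (etrans (size_theta_word s') n0)).
apply: (@eq_from_nth _ (Ordinal n_gt0)); first by rewrite !size_theta_word.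
move=> i; rewrite size_theta_word => lt_in.
have := E (Ordinal lt_in); rewrite !permE /theta_fun /= => Ei.
by rewrite !(set_nth_default (Ordinal lt_in) (Ordinal n_gt0)) ?size_theta_word.
Qed.

Definition hat p : 'S_n := invF theta_inj p.

Lemma thetaK : cancel theta hat.
Proof. exact: invF_f. Qed.

Lemma hatK : cancel hat theta.
Proof. exact: f_invF. Qed.

End FundamentalBijection.

(* An arrow pattern (nu; H) of size k; the letter a of [k] is represented by
   the ordinal a - 1 of 'I_k, and the arrow b -> c by the pair (b, c). *)
Record arrow_pattern (k : nat) := ArrowPattern {
  ap_word : seq 'I_k;
  ap_arrows : {set 'I_k * 'I_k};
  ap_onto : forall a : 'I_k,
    a \in ap_word \/ exists2 e, e \in ap_arrows & a = e.1 \/ a = e.2 }.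

(* x enumerates X = {x_1 < ... < x_k} and t lists the positions
   t_1 < ... < t_m. *)
Definition contains n k (p : 'S_n) (P : arrow_pattern k) : bool :=
  [exists x : {ffun 'I_k -> 'I_n}, exists t : (size (ap_word P)).-tuple 'I_n,
    [&& [forall a : 'I_k, forall b : 'I_k, (a < b) ==> (x a < x b)],
        sorted (fun i j : 'I_n => i < j) t,
        [seq p i | i <- t] == [seq x a | a <- ap_word P] &
        [forall e in ap_arrows P, hat p (x e.1) == x e.2]]].

Definition avoids n k (p : 'S_n) (P : arrow_pattern k) : bool :=
  ~~ contains p P.

(* The 1-based letter a, for 1 <= a <= k. *)
Definition letter k a (lt_ak : a.-1 < k) : 'I_k := Ordinal lt_ak.

Lemma pattern_12_1to3_onto (a : 'I_3) :
  a \in [:: @letter 3 1 isT; @letter 3 2 isT] \/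
  exists2 e, e \in [set (@letter 3 1 isT, @letter 3 3 isT)] & a = e.1 \/ a = e.2.
Proof.
case: a => [[|[|[|//]]] lt_a3]; [by left | by left | right].
exists (@letter 3 1 isT, @letter 3 3 isT); first by rewrite inE.
by right; apply: val_inj.
Qed.

(* (12; 1 -> 3) *)
Definition pattern_12_1to3 : arrow_pattern 3 :=
  ArrowPattern pattern_12_1to3_onto.

Lemma pattern_1_1to1_onto (a : 'I_1) :
  a \in [:: @letter 1 1 isT] \/
  exists2 e, e \in [set (@letter 1 1 isT, @letter 1 1 isT)] & a = e.1 \/ a = e.2.
Proof. by left; rewrite (ord1 a). Qed.

(* (1; 1 -> 1) *)
Definition pattern_1_1to1 : arrow_pattern 1 :=
  ArrowPattern pattern_1_1to1_onto.

Lemma avoids_1_1to1 n (p : 'S_n) :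
  avoids p pattern_1_1to1 = [forall i, hat p i != i].
Proof.
rewrite /avoids -negb_exists; congr (~~ _); apply/existsP/existsP.
  case=> x /existsP[t /and4P[_ _ _ /forall_inP H]].
  by exists (x ord0); apply: (H (ord0, ord0)); rewrite inE.
case=> i /eqP hi; exists [ffun=> i]; apply/existsP.
exists [tuple (p^-1)%g i]; apply/and4P; split=> //=.
- by apply/forallP => a; apply/forallP => b; rewrite !ord1.
- by rewrite permKV ffunE.
- by apply/forall_inP => e _; rewrite !ffunE hi.
Qed.

Definition num_avoiders (n : nat) : nat :=
  #|[set p : 'S_n | avoids p pattern_12_1to3 && avoids p pattern_1_1to1]|.

Lemma num_avoiders0 : num_avoiders 0 = 1.
Proof.
rewrite /num_avoiders (_ : [set _ | _] = setT) ?cardsT ?card_Sn //.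
apply/setP => p; rewrite !inE; apply/andP.
by split; apply/existsPn => x; case: (x ord0).
Qed.

(* Main.v *)
Require Import Defs.
From mathcomp Require Import all_boot.
From mathcomp Require Import perm zify.

(* Let w be the word of p and s = hat p, and suppose s has no forbidden arrow:
   no x < z < s x with x before z in w.  Following a cycle of s around, an entry
   z of a later cycle must lie above the maximum of the cycle or below its
   minimum, so avoidance means that the cycles form a noncrossing partition and
   that each of them, read from its maximum, avoids 13-2.
   Let N be the largest letter and l the last letter of w.  The last cycle is
   N G S l with G > l > S, and every other cycle lies entirely below or entirely
   above l.  Replacing the last cycle by (l S) and (N G) gives two avoiders, on
   the letters <= l and on the letters > l, whose only possible fixed point is
   their largest letter; this is a bijection, and dropping a fixed largest letter
   shows that there are a_k + a_(k-1) such avoiders of size k. *)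

Set Implicit Arguments.
Unset Strict Implicit.
Unset Printing Implicit Defensive.

(* [clear_ascents] is avoidance of 13-2; the default of [head] is harmless, since
   the bound variable then ranges over the empty list. *)
Fixpoint clear_ascents (c : seq nat) : bool :=
  if c is x :: t then
    all (fun z => ~~ (x < z < head 0 t)) t && clear_ascents t
  else true.

(* [d] comes after [c]; both start with their largest letter. *)
Definition noncrossing_pair (c d : seq nat) : bool :=
  (head 0 c < head 0 d) && all (fun z => (head 0 c < z) || all (ltn z) c) d.

Definition good_cycle (c : seq nat) : bool :=
  [&& c != [::], all (geq (head 0 c)) c & clear_ascents c].

Definition good_form (cs : seq (seq nat)) : bool :=
  all good_cycle cs && pairwise noncrossing_pair cs.

Definition cycle_form n (s : 'S_n) : seq (seq nat) :=
  [seq map val c | c <- std_cycle_form s].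

(** Heads increase and each bounds its own cycle, so the first letter exceeding the first head
    starts the second cycle. The word thus determines its parentheses. *)
Lemma flatten_std_form_inj (cs ds : seq (seq nat)) :
    all (fun c => (c != [::]) && all (geq (head 0 c)) c) cs ->
    all (fun c => (c != [::]) && all (geq (head 0 c)) c) ds ->
    sorted ltn (map (head 0) cs) -> sorted ltn (map (head 0) ds) ->
  flatten cs = flatten ds -> cs = ds.
Proof.
elim: cs ds => [|[|x c] cs IH] [|[|y d] ds] //=.
rewrite leqnn /= => /andP[cx wcs] /andP[]/= + + + + [xy]; rewrite -{y}xy leqnn /=.
move=> dx wds pcs pds E.
have cut (b : seq nat) bs : all (geq x) b ->
    all (fun c => (c != [::]) && all (geq (head 0 c)) c) bs ->
    path ltn x (map (head 0) bs) ->
    find (ltn x) (b ++ flatten bs) = size b.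
  move=> bx wbs pbs; rewrite find_cat ifF; last first.
    by apply/negbTE/hasPn => z /(allP bx) /=; rewrite leqNgt.
  case: bs wbs pbs => [|[|z b'] bs] //=; rewrite ?addn0 //.
  by move=> _ /andP[-> _]; rewrite addn0.
have sE : size c = size d by rewrite -(cut c cs) // -(cut d ds) // E.
move/eqP: E; rewrite eqseq_cat // => /andP[/eqP-> /eqP E].
by congr (_ :: _); apply: IH (path_sorted pcs) (path_sorted pds) _.
Qed.

(** * Avoidance read off the cycle form *)

Section CycleForm.

Variables (n : nat) (s : 'S_n).

Lemma flatten_cycle_form : flatten (cycle_form s) = map val (theta_word s).
Proof. by rewrite map_flatten; congr flatten. Qed.

Lemma cycle_form_heads : sorted ltn (map (head 0) (cycle_form s)).
Proof.
rewrite /cycle_form /std_cycle_form -!map_comp.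
rewrite (@eq_map _ _ _ val); last first.
  by move=> x /=; rewrite /orbit -orderSpred.
rewrite sorted_map; apply: sorted_filter; first by move=> ? ? ?; apply: ltn_trans.
by rewrite -(@sorted_map _ _ val ltn) val_enum_ord iota_ltn_sorted.
Qed.

Lemma cycle_form_max :
  all (fun c => (c != [::]) && all (geq (head 0 c)) c) (cycle_form s).
Proof.
rewrite !all_map; apply/allP => x; rewrite mem_filter => /andP[xmax _] /=.
by move: xmax; rewrite /orbit -orderSpred /= all_map.
Qed.

(** Along a trajectory the entry after [y] is [s y]; the last entry has no later letter to test. *)
Lemma clear_ascents_traject x k :
  clear_ascents (map val (traject s x k))
  = pairwise (fun y z : 'I_n => ~~ (y < z < s y)) (traject s x k).
Proof.
elim: k x => //= k IH x; rewrite IH all_map; congr andb.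
by case: k {IH}.
Qed.

(** A cycle with letters on both sides of [z] has an arrow from below [z] to above it, so avoidance
    puts [z] outside the range of the cycle. The list [e] will be the word of the later cycles. *)
Lemma noncrossing_arrows (m : 'I_n) (e : seq 'I_n) :
    all (fun y : 'I_n => y <= m) (orbit s m) ->
    (forall z, z \in e -> z \notin orbit s m) ->
  allrel (fun y z : 'I_n => ~~ (y < z < s y)) (orbit s m) e
  = all (fun z => (m < z) || all (ltn z) (map val (orbit s m))) (map val e).
Proof.
move=> mmax edisj; rewrite all_map; apply/allrelP/allP => H.
  move=> z ze /=; rewrite all_map; case: ltnP => //= zm; apply/allP => y ym /=.
  (* Going backwards from [m], no arrow of the cycle jumps over [z]. *)
  have : fconnect s y m by rewrite (fconnect_sym perm_inj) fconnect_orbit.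
  case/iter_findex; move: (findex _ _ _) => k.
  elim: k y ym => [|k IH] y ym /= kE.
    rewrite kE ltn_neqAle zm andbT.
    by apply: contraNneq (edisj z ze) => /val_inj ->; apply: in_orbit.
  rewrite -iterS iterSr in kE.
  have sym : s y \in orbit s m.
    by rewrite -!fconnect_orbit in ym *; apply: connect_trans ym (fconnect1 _ _).
  have := H _ _ ym ze; rewrite (IH _ sym kE) andbT -leqNgt leq_eqVlt orbC.
  case/orP => // /eqP/val_inj zy; by have := edisj z ze; rewrite zy ym.
move=> y z ym ze; have := H z ze => /=.
have sym : s y \in orbit s m.
  by rewrite -!fconnect_orbit in ym *; apply: connect_trans ym (fconnect1 _ _).
rewrite all_map => /orP[mz|/allP/(_ _ ym) /= zy].
  by rewrite negb_and -!leqNgt (leq_trans (allP mmax _ sym) (ltnW mz)) orbT.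
by rewrite negb_and -!leqNgt (ltnW zy).
Qed.

(** Pairs of letters within one cycle account for [clear_ascents], pairs from two cycles for
    [noncrossing_pair]. *)
Lemma good_cycle_form :
  good_form (cycle_form s)
  = pairwise (fun y z : 'I_n => ~~ (y < z < s y)) (theta_word s).
Proof.
have : all (fun x : 'I_n => all (fun y : 'I_n => y <= x) (orbit s x)) (cycle_maxima s).
  by apply/allP => x; rewrite mem_filter => /andP[].
move: cycle_form_heads (theta_word_uniq s).
rewrite /good_form /cycle_form /theta_word /std_cycle_form -!map_comp.
elim: (cycle_maxima s) => //= x xs IH srt.
rewrite cat_uniq => /and3P[_ disj uxs] /andP[xmax xsmax].
rewrite pairwise_cat -(IH (path_sorted srt) uxs xsmax) noncrossing_arrows //; last first.
  by move=> z zxs; apply: contra disj => zx; apply/hasP; exists z.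
have orbE : head 0 (map val (orbit s x)) = x by rewrite /orbit -orderSpred.
rewrite {1}/good_cycle orbE {2}/orbit clear_ascents_traject.
rewrite all_map [all _ (orbit s x)]xmax.
have -> : map val (orbit s x) != [::] by rewrite /orbit -orderSpred.
(* Heads increase in every cycle form, so only the second half of [noncrossing_pair] remains, and it
   can be tested on the concatenation of the later cycles. *)
rewrite (_ : all (noncrossing_pair _) _
  = all (fun z => (x < z) || all (ltn z) (map val (orbit s x)))
        [seq val i | i <- flatten [seq orbit s x | x <- xs]]); last first.
  move: srt; rewrite /= orbE => /(order_path_min ltn_trans).
  elim: xs {IH disj uxs xsmax} => //= y ys IH.
  rewrite map_cat all_cat => /andP[xy /IH ->].
  by rewrite /noncrossing_pair orbE xy.
rewrite -/(orbit s x) /=; set P := pairwise _ (orbit s x).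
by case: P; rewrite /= ?andbF // [LHS]andbCA.
Qed.

End CycleForm.

(** The third letter of an occurrence is the image of the first, so an occurrence amounts to two
    positions of the word. *)
Lemma avoids_12_1to3 n (p : 'S_n) :
  avoids p pattern_12_1to3 = good_form (cycle_form (hat p)).
Proof.
rewrite good_cycle_form -[p in LHS]hatK; move: (hat p) => s.
have thE (i : 'I_n) : theta s i = nth i (theta_word s) i by rewrite permE.
case: (posnP n) => [n0|n_gt0].
  rewrite (size0nil (etrans (size_theta_word s) n0)).
  apply/existsPn => x; exfalso.
  by have := leq_ltn_trans (leq0n _) (ltn_ord (x ord0)); rewrite n0.
pose x0 := Ordinal n_gt0; apply/idP/(pairwiseP x0) => [av i j|H].
  rewrite !inE !size_theta_word => lti ltj ij; apply: contra av.
  set a := nth _ _ i; set b := nth _ _ j => ab.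
  have thi : theta s (Ordinal lti) = a.
    by rewrite thE /=; apply: set_nth_default; rewrite size_theta_word.
  have thj : theta s (Ordinal ltj) = b.
    by rewrite thE /=; apply: set_nth_default; rewrite size_theta_word.
  (* The set X is {a, b, s a}; the default [a] is never reached. *)
  apply/existsP; exists [ffun e : 'I_3 => nth a [:: a; b; s a] e].
  apply/existsP; exists [tuple Ordinal lti; Ordinal ltj].
  apply/and4P; split => /=.
  - apply/forallP => e; apply/forallP => f; apply/implyP; rewrite !ffunE.
    case/andP: ab => ab bs.
    case: e f => [[|[|[|//]]] ?] [[|[|[|//]]] ?] //= _.
    exact: ltn_trans bs.
  - by rewrite ij.
  - by rewrite thi thj !ffunE.
  - by apply/forall_inP => e; rewrite inE => /eqP->; rewrite !ffunE /= thetaK.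
apply/existsPn => x; apply/existsPn => -[[|i [|j [|]]] //= st].
apply/and4P => -[/forallP mx /andP[ij _] /eqP[xi xj] /forall_inP].
move=> /(_ (letter (k := 3) (a := 1) isT, letter (k := 3) (a := 3) isT)).
rewrite inE eqxx thetaK => /(_ isT)/eqP /= sx.
have /negP[] := H i j (ltac:(by rewrite inE size_theta_word))
  (ltac:(by rewrite inE size_theta_word)) ij.
rewrite !(set_nth_default i x0) ?size_theta_word // -thE.
rewrite (set_nth_default j i) ?size_theta_word // -thE xi xj sx.
by rewrite !(implyP (forallP (mx _) _)).
Qed.

Lemma avoids_1_1to1_form n (p : 'S_n) :
  avoids p pattern_1_1to1 = all (fun c => 1 < size c) (cycle_form (hat p)).
Proof.
rewrite avoids_1_1to1; move: (hat p) => s; rewrite !all_map.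
apply/forallP/allP => [fixN x _|H x] /=.
  rewrite size_map size_orbit ltn_neqAle order_gt0 andbT eq_sym.
  by apply: contraNneq (fixN x) => o1; rewrite -[X in _ == X](iter_order (@perm_inj _ s)) o1.
(* Iterating from a fixed point [x] never leaves it, so the maximum [y] of its cycle is [x], and a
   cycle of length above 1 would list [x] twice. *)
apply/eqP => sx; have [y ys xy] := cycle_maximaP s x.
have := H y ys => /=; rewrite size_map size_orbit.
have : fconnect s x y by rewrite (fconnect_sym perm_inj) fconnect_orbit.
case/iter_findex; rewrite iter_fix // => <-.
have := orbit_uniq s x; rewrite /orbit.
by case: order => [|[|k]] //=; rewrite sx inE eqxx.
Qed.

(** * Which good forms are cycle forms of permutations *)

Lemma perm_theta_word n (s : 'S_n) :
  perm_eq (map val (theta_word s)) (iota 0 n).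
Proof.
rewrite -val_enum_ord perm_map //.
apply: uniq_perm; rewrite ?enum_uniq ?theta_word_uniq // => x.
rewrite mem_enum; apply/flatten_mapP.
by have [y] := cycle_maximaP s x; exists y.
Qed.

Lemma good_form_max cs : good_form cs ->
  all (fun c => (c != [::]) && all (geq (head 0 c)) c) cs.
Proof. by move=> /andP[/allP H _]; apply/allP => c /H /and3P[-> ->]. Qed.

Lemma good_form_heads cs : good_form cs -> sorted ltn (map (head 0) cs).
Proof.
case/andP=> _ /pairwise_sorted; rewrite sorted_map.
by apply: sub_sorted => c d /andP[].
Qed.

Lemma cycle_form_inj n : injective (@cycle_form n).
Proof.
move=> s s' E; apply: theta_word_inj; apply: (inj_map val_inj).
by rewrite -!flatten_cycle_form E.
Qed.

(** Counting replaces the construction of a permutation from [cs]: the words of the n! permutations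
    are distinct rearrangements of [iota 0 n], hence all of them. *)
Lemma mem_cycle_forms n (cs : seq (seq nat)) : good_form cs ->
  (cs \in codom (@cycle_form n)) = perm_eq (flatten cs) (iota 0 n).
Proof.
move=> good; apply/codomP/idP => [[s ->]|].
  by rewrite flatten_cycle_form perm_theta_word.
rewrite -mem_permutations.
pose w (s : 'S_n) : seq nat := map val (theta_word s).
have w_inj : injective w by move=> s s' /(inj_map val_inj)/theta_word_inj.
have w_uniq : uniq (codom w) by rewrite map_inj_uniq ?enum_uniq.
have subw : {subset codom w <= permutations (iota 0 n)}.
  by move=> _ /codomP[s ->]; rewrite mem_permutations perm_theta_word.
have [|_ <-] := uniq_min_size w_uniq subw.
  by rewrite size_permutations ?iota_uniq // size_iota size_codom card_Sn.
case/codomP=> s; rewrite /w -flatten_cycle_form => E; exists s.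
exact: (flatten_std_form_inj (good_form_max good) (cycle_form_max s)
          (good_form_heads good) (cycle_form_heads s) E).
Qed.

(** * Separating and translating letters *)

(** Serves twice when a form is split at [l]: for the cycles, where the low ones come first, and for
    the letters of the last cycle, where the high ones come first. *)
Lemma split_pairwise (T : eqType) (a : pred T) (s : seq T) :
  pairwise (fun x y => a y ==> a x) s ->
  s = [seq x <- s | a x] ++ [seq x <- s | ~~ a x].
Proof.
elim: s => //= x s IH /andP[xs /IH sE]; case: (boolP (a x)) xs => ax xs /=.
  by rewrite -sE.
have saN : all (predC a) s by apply: sub_all xs => y; rewrite implybF.
rewrite (_ : filter a s = [::]) ?(all_filterP saN) //.
by apply/eqP; rewrite -[_ == _]negbK -has_filter -all_predC.
Qed.

Section Shift.

Variable k : nat.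

Lemma clear_ascents_shift c : clear_ascents (map (addn k) c) = clear_ascents c.
Proof.
elim: c => //= x t ->; rewrite all_map; congr andb.
by case: t => //= y t; rewrite !ltn_add2l; congr andb; apply: eq_all => z /=;
  rewrite !ltn_add2l.
Qed.

Lemma head_shift c : c != [::] -> head 0 (map (addn k) c) = k + head 0 c.
Proof. by case: c. Qed.

Lemma good_cycle_shift c : good_cycle (map (addn k) c) = good_cycle c.
Proof.
rewrite /good_cycle clear_ascents_shift; case: c => //= x t.
rewrite all_map !leqnn; congr (_ && _).
by apply: eq_all => z /=; rewrite leq_add2l.
Qed.

Lemma good_form_shift cs : good_form (map (map (addn k)) cs) = good_form cs.
Proof.
rewrite /good_form all_map (eq_all good_cycle_shift).
case: (boolP (all _ _)) => //= gcs; rewrite pairwise_map.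
(* Good cycles are nonempty; the default head 0 of an empty list would not be translated. *)
apply: (eq_in_pairwise (P := good_cycle)); last exact: gcs.
move=> c d /and3P[c0 _ _] /and3P[d0 _ _]; rewrite /= /noncrossing_pair.
rewrite !head_shift // ltn_add2l all_map; congr andb; apply: eq_all => z /=.
by rewrite all_map ltn_add2l; congr orb; apply: eq_all => y /=; rewrite ltn_add2l.
Qed.

End Shift.

(** * Merging two last cycles into one *)

Lemma clear_ascents_rcons t l :
  all (gtn l) t -> clear_ascents (rcons t l) = clear_ascents t.
Proof.
elim: t => //= x t IH /andP[_ tl]; rewrite IH // all_rcons; congr (_ && _).
case: t tl {IH} => [_|y t /andP[/= yl _]] /=; first by rewrite ltnn andbF.
by rewrite [l < y]ltnNge (ltnW yl) andbF.
Qed.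

(** No letter of [rcons t l] exceeds a letter of [b], so the two blocks do not interact. Moving [l]
    from the end to the front is harmless because all of [t] is smaller. *)
Lemma clear_ascents_cat b t l : all (ltn l) b -> all (gtn l) t ->
  clear_ascents (b ++ rcons t l) = clear_ascents b && clear_ascents (l :: t).
Proof.
move=> + tl; elim: b => [_|x b IH /= /andP[lx lb]].
  rewrite clear_ascents_rcons //=; have -> // : all (fun z => ~~ (l < z < head 0 t)) t.
  by apply: sub_all tl => z /= zl; rewrite ltnNge (ltnW zl).
rewrite IH // andbA; congr (_ && _ && _).
have low z : z <= l -> ~~ (x < z).
  by rewrite -leqNgt => zl; apply: leq_trans zl (ltnW lx).
have tx : all (fun z => ~~ (x < z)) (rcons t l).
  by rewrite all_rcons low //; apply: sub_all tl => z /ltnW/low.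
case: b {IH lb} => [|y b] /=.
  by apply: sub_all tx => z; rewrite negb_and => ->.
rewrite all_cat andbA; have -> : all (fun z => ~~ (x < z < y)) (rcons t l).
  by apply: sub_all tx => z; rewrite negb_and => ->.
by rewrite andbT.
Qed.

Lemma good_cycle_merge h g t l : all (gtn l) t -> all (ltn l) (h :: g) ->
  good_cycle ((h :: g) ++ rcons t l) = good_cycle (h :: g) && good_cycle (l :: t).
Proof.
move=> tl lhg; have /andP[lh lg] := lhg.
rewrite /good_cycle clear_ascents_cat //= !leqnn all_cat all_rcons /=.
rewrite (ltnW lh) /=.
have -> : all (geq l) t by apply: sub_all tl => z /ltnW.
have -> : all (geq h) t by apply: sub_all tl => z /= zl; apply/ltnW/(ltn_trans zl).
by rewrite !andbT -?andbA.
Qed.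

(** Cycles of [U1] have heads below [l], so they never conflict with letters above [l]; cycles of
    [U2] lie above [l], so they never conflict with [t] or [l]. What remains are the conditions
    inside the two smaller forms. *)
Lemma good_form_merge U1 U2 h g t l :
    all (gtn l) (flatten U1 ++ t) -> all (ltn l) (flatten U2 ++ h :: g) ->
  good_form (U1 ++ U2 ++ [:: (h :: g) ++ rcons t l])
  = good_form (rcons U1 (l :: t)) && good_form (rcons U2 (h :: g)).
Proof.
rewrite !all_cat => /andP[U1l tl] /andP[lU2 lhg].
rewrite /good_form -[rcons U1 _]cats1 -[rcons U2 _]cats1 !all_cat !all_seq1 good_cycle_merge //.
case: (boolP (all good_cycle U1)) => //= gU1.
case: (boolP (all good_cycle U2)) => //= gU2; last by rewrite !andbF.
have headlt c : c \in U1 -> head 0 c < l.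
  move=> cU1; have /and3P[c0 _ _] := allP gU1 c cU1; apply: (allP U1l).
  by apply/flattenP; exists c => //; case: c {cU1} c0 => //= *; rewrite mem_head.
have headgt c : c \in U2 -> l < head 0 c.
  move=> cU2; have /and3P[c0 _ _] := allP gU2 c cU2; apply: (allP lU2).
  by apply/flattenP; exists c => //; case: c {cU2} c0 => //= *; rewrite mem_head.
have /andP[lh _] := lhg.
have above c d : c \in U1 -> all (ltn l) d ->
    all (fun z => (head 0 c < z) || all (ltn z) c) d.
  move=> /headlt cl; apply: sub_all => z /= lz; by rewrite (ltn_trans cl lz).
have below c d : c \in U2 -> all (geq l) d ->
    all (fun z => (head 0 c < z) || all (ltn z) c) d.
  move=> cU2; apply: sub_all => z /= zl; apply/orP; right; apply/allP => y yc /=.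
  by apply: leq_ltn_trans zl (allP lU2 _ _); apply/flattenP; exists c.
rewrite !pairwise_cat !andbT !allrel_catr.
have -> : allrel noncrossing_pair U1 U2.
  apply/allrelP => c d cU1 dU2; rewrite /noncrossing_pair above //.
    by rewrite (ltn_trans (headlt c cU1) (headgt d dU2)).
  by apply/allP => y yd; apply: (allP lU2); apply/flattenP; exists d.
have -> : allrel noncrossing_pair U1 [:: (h :: g) ++ rcons t l]
        = allrel noncrossing_pair U1 [:: l :: t].
  rewrite !allrel1r; apply: eq_in_all => c cU1; rewrite /noncrossing_pair all_cat above //.
  by rewrite /= all_rcons headlt // (ltn_trans (headlt c cU1) lh).
have -> : allrel noncrossing_pair U2 [:: (h :: g) ++ rcons t l]
        = allrel noncrossing_pair U2 [:: h :: g].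
  rewrite !allrel1r; apply: eq_in_all => c cU2; rewrite /noncrossing_pair all_cat.
  rewrite [X in _ && (_ && X)]below ?andbT // all_rcons /= leqnn.
  by apply: sub_all tl => z /ltnW.
rewrite andTb.
move: (good_cycle (h :: g)) (good_cycle (l :: t)) (allrel _ U1 _) (allrel _ U2 _).
by move: (pairwise _ U1) (pairwise _ U2) => [] [] [] [] [] [].
Qed.

(** * Splitting the last cycle at its last letter *)

(** Heads increase, so a cycle headed by the largest letter can only be the last one. *)
Lemma good_form_last n cs : good_form cs -> perm_eq (flatten cs) (iota 0 n.+1) ->
  exists U v, cs = rcons U (n :: v).
Proof.
move=> /andP[/allP gcs ncs] pcs.
have memcs z c : c \in cs -> z \in c -> z <= n.
  move=> ccs zc; suff: z \in iota 0 n.+1 by rewrite mem_iota.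
  by rewrite -(perm_mem pcs); apply/flattenP; exists c.
have : n \in flatten cs by rewrite (perm_mem pcs) mem_iota /=.
case/lastP: cs gcs ncs memcs {pcs} => [//|U c] gcs ncs memcs /flattenP[d dcs nd].
have cU : c \in rcons U c by rewrite mem_rcons mem_head.
case/and3P: (gcs c cU) => c0 _ _; have := memcs (head 0 c) c cU.
have -> : head 0 c \in c by case: c c0 {gcs ncs memcs dcs cU} => //= *; rewrite mem_head.
move=> /(_ isT) cn; have /and3P[_ /allP/(_ n nd) /= nd' _] := gcs d dcs.
exists U, (behead c).
suff: head 0 c = n by case: c c0 {gcs ncs memcs dcs cU cn} => //= x c _ ->.
move: dcs; rewrite mem_rcons inE => /predU1P[dc|dU].
  by apply/eqP; rewrite eqn_leq cn -dc.
move: ncs; rewrite pairwise_rcons => /andP[/allP/(_ d dU)/andP[dc _] _].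
by have := leq_trans dc (leq_trans cn nd'); rewrite ltnn.
Qed.

(** Testing against the final [l]: no letter below [l] is directly followed by one above it, so the
    letters above [l] come first. *)
Lemma clear_ascents_split l v : l \notin v -> clear_ascents (rcons v l) ->
  v = [seq x <- v | l < x] ++ [seq x <- v | ~~ (l < x)].
Proof.
move=> lv clear; apply: split_pairwise.
rewrite -sorted_pairwise; last first.
  by move=> y x z /implyP yx /implyP zy; apply/implyP => /zy/yx.
elim: v lv clear => //= x [|y v] IH //=.
rewrite inE negb_or => /andP[lx lv] /andP[]; rewrite all_rcons => /andP[_ /andP[xly _]].
move/(IH lv) => /= ->; rewrite andbT; apply/implyP => ly.
by move: xly; rewrite ly andbT -leqNgt leq_eqVlt (negPf lx).
Qed.

Lemma head_flatten (P : pred nat) cs : all good_cycle cs -> all P (flatten cs) ->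
  all (fun c => P (head 0 c)) cs.
Proof.
move=> gcs Pcs; apply/allP => -[/(allP gcs)//|x c] xccs.
by apply: (allP Pcs); apply/flattenP; exists (x :: c); rewrite // mem_head.
Qed.

Lemma good_form_split n cs :
    good_form cs -> all (fun c => 1 < size c) cs ->
    perm_eq (flatten cs) (iota 0 n.+1) ->
  exists U1 l t U2 g,
    [/\ cs = U1 ++ U2 ++ [:: (n :: g) ++ rcons t l],
        all (gtn l) (flatten U1 ++ t) & all (ltn l) (flatten U2 ++ n :: g)].
Proof.
move=> gcs szcs pcs; have [U [v csE]] := good_form_last gcs pcs.
have ucs : uniq (flatten cs) by rewrite (perm_uniq pcs) iota_uniq.
have ltcs x : x \in flatten cs -> x <= n by rewrite (perm_mem pcs) mem_iota.
subst cs; move: szcs; rewrite all_rcons /= => /andP[].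
(* The last cycle has length above 1, which rules out an empty [v]. *)
case/lastP: v gcs pcs ucs ltcs => // v l gcs pcs ucs ltcs _ szU.
move: ucs; rewrite flatten_rcons cat_uniq cons_uniq rcons_uniq.
move=> /and3P[_ /hasPn disj /and3P[nv lv uv]].
have ln : l < n.
  rewrite ltn_neqAle ltcs ?flatten_rcons ?mem_cat ?inE ?mem_rcons ?mem_head ?orbT //.
  by rewrite andbT; apply: contraNneq nv => ->; rewrite mem_rcons mem_head.
have lU : l \notin flatten U by apply: disj; rewrite inE mem_rcons mem_head orbT.
have /andP[] := gcs; rewrite all_rcons pairwise_rcons.
move=> /andP[/and3P[_ _ /andP[_ clv]] gU] /andP[lastU pU].
(* Noncrossing with the last cycle, tested at its letter [l], keeps each earlier cycle on one side
   of [l]; the head tells which. *)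
pose low := fun c => head 0 c < l.
have lowP c : c \in U -> all (if low c then gtn l else ltn l) c.
  move=> cU; have /and3P[c0 cmax _] := allP gU c cU.
  have /andP[_ /allP/(_ l)] := allP lastU c cU.
  rewrite inE mem_rcons mem_head orbT => /(_ isT); rewrite -/(low c).
  case: ifP => [cl _|_ /= //].
  by apply: sub_all cmax => z /= zc; apply: leq_ltn_trans cl.
exists [seq c <- U | low c], l, [seq x <- v | ~~ (l < x)],
       [seq c <- U | ~~ low c], [seq x <- v | l < x].
split.
- rewrite -cats1 [U in LHS](split_pairwise (a := low)) -?catA; last first.
    apply: sub_pairwise pU => c d /andP[cd _]; apply/implyP; exact: ltn_trans.
  congr (_ ++ (_ ++ [:: n :: _])).
  by rewrite -!cats1 catA -clear_ascents_split.
- rewrite all_cat all_filter; apply/andP; split; last first.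
    apply/allP => x xv /=; rewrite -leqNgt leq_eqVlt; apply/implyP.
    by case/predU1P => // xl; rewrite -xl xv in lv.
  apply/allP => x /flattenP[c]; rewrite mem_filter => /andP[cl cU] xc.
  by have := lowP c cU; rewrite cl => /allP; apply.
- rewrite all_cat /= ln filter_all !andbT.
  apply/allP => x /flattenP[c]; rewrite mem_filter => /andP[/negPf cl cU] xc.
  by have := lowP c cU; rewrite cl => /allP; apply.
Qed.

(** * Counting forms, with or without a fixed largest letter *)

(** Forms of all sizes share one type, so translating and merging them needs no cast. *)
Definition forms n (Q : pred (seq (seq nat))) : seq (seq (seq nat)) :=
  [seq cs <- codom (@cycle_form n) | good_form cs && Q cs].

Definition long_cycles (cs : seq (seq nat)) := all (fun c => 1 < size c) cs.

(* Letters are 0-based, so [n.-1] is the largest letter when [0 < n]. *)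
Definition long_or_max n (cs : seq (seq nat)) :=
  all (fun c => (1 < size c) || (c == [:: n.-1])) cs.

Lemma forms_uniq n Q : uniq (forms n Q).
Proof. by rewrite filter_uniq // map_inj_uniq ?enum_uniq //; apply: cycle_form_inj. Qed.

Lemma mem_forms n Q cs :
  (cs \in forms n Q) = [&& perm_eq (flatten cs) (iota 0 n), good_form cs & Q cs].
Proof.
rewrite mem_filter; case: (boolP (good_form cs)) => //= good; rewrite ?andbF //.
by rewrite andbC mem_cycle_forms.
Qed.

Lemma num_avoiders_forms n : num_avoiders n = size (forms n long_cycles).
Proof.
rewrite /num_avoiders size_filter count_map.
set P := preim _ _; rewrite (_ : count P _ = #|[set s | P s]|); last first.
  by rewrite cardsE cardE -size_filter enumT /enum_mem; congr size; apply: eq_filter.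
rewrite -[RHS](card_imset _ (@theta_inj n)).
apply: eq_card => p; rewrite [LHS]inE avoids_12_1to3 avoids_1_1to1_form.
by rewrite -[p in RHS]hatK mem_imset ?inE //; apply: theta_inj.
Qed.

(** The letter [n] occurs only once, as head of the last cycle, so the singleton that [long_or_max]
    permits can only be that cycle. *)
Lemma long_or_max_last n cs : cs \in forms n.+1 (long_or_max n.+1) ->
  exists U v, [/\ cs = rcons U (n :: v), all (gtn n) (flatten U ++ v) & long_cycles U].
Proof.
rewrite mem_forms => /and3P[pcs gcs lcs]; have [U [v csE]] := good_form_last gcs pcs.
have Uv_lt : all (gtn n) (flatten U ++ v).
  have : uniq (flatten cs) by rewrite (perm_uniq pcs) iota_uniq.
  rewrite csE flatten_rcons -cat1s uniq_catCA cat1s cons_uniq => /andP[nUv _].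
  apply/allP => x xUv; rewrite /= ltn_neqAle; apply/andP; split.
    by apply: contraNneq nUv => <-.
  suff: x \in iota 0 n.+1 by rewrite mem_iota.
  rewrite -(perm_mem pcs) csE flatten_rcons; move: xUv; rewrite !mem_cat inE.
  by case/orP => ->; rewrite ?orbT.
exists U, v; split=> //.
apply/allP => c cU; have := allP lcs c; rewrite csE mem_rcons inE cU orbT => /(_ isT).
case/orP => // /eqP cE; have : n \in flatten U ++ v.
  by rewrite mem_cat; apply/orP; left; apply/flattenP; exists c; rewrite // cE mem_head.
by move/(allP Uv_lt) => /=; rewrite ltnn.
Qed.

Lemma long_or_max_rcons n U v : all (gtn n) (flatten U ++ v) ->
  long_or_max n.+1 (rcons U (n :: v)) = long_cycles U.
Proof.
rewrite all_cat /long_or_max all_rcons => /andP[Un _] /=.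
rewrite (_ : _ || _) /=; last by case: v => [|x v] //=; rewrite eqxx.
apply: eq_in_all => c cU; case: eqP => [cE|_]; last by rewrite orbF.
have : n \in flatten U by apply/flattenP; exists c; rewrite // cE mem_head.
by move/(allP Un) => /=; rewrite ltnn.
Qed.

Lemma size_long_or_max n :
  size (forms n.+1 (long_or_max n.+1))
  = size (forms n.+1 long_cycles) + size (forms n long_cycles).
Proof.
rewrite -(size_map (rcons^~ [:: n]) (forms n _)) -size_cat; apply/perm_size.
have perm_rcons U : perm_eq (flatten (rcons U [:: n])) (iota 0 n.+1)
                  = perm_eq (flatten U) (iota 0 n).
  by rewrite flatten_rcons -(addn1 n) iotaD perm_cat2r.
apply: uniq_perm; rewrite ?forms_uniq // ?cat_uniq.
  rewrite !forms_uniq map_inj_uniq ?forms_uniq ?andbT; last first.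
    by move=> U U' /eqP; rewrite eqseq_rcons => /andP[/eqP].
  apply/hasPn => _ /mapP[U _ ->]; rewrite mem_forms.
  by rewrite /long_cycles all_rcons /= !andbF.
move=> cs; rewrite mem_cat; apply/idP/orP => [cs_in|[]].
(* An empty [v] means that [n] is fixed; otherwise every cycle is long. *)
- have [U [[|x v] [csE Un longU]]] := long_or_max_last cs_in.
    right; apply/mapP; exists U => //; move: cs_in; rewrite !mem_forms csE perm_rcons.
    case/and3P=> -> /andP[]; rewrite all_rcons pairwise_rcons.
    by rewrite /good_form => /andP[_ ->] /andP[_ ->] _; rewrite longU.
  left; move: cs_in; rewrite !mem_forms => /and3P[-> -> _].
  by rewrite csE /long_cycles all_rcons; apply/andP.
- rewrite !mem_forms => /and3P[-> -> /= longcs].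
  by apply: sub_all longcs => c ->.
- case/mapP=> U; rewrite !mem_forms => /and3P[pU /andP[gU prU] longU] ->.
  have Un : all (gtn n) (flatten U).
    by apply/allP => x; rewrite (perm_mem pU) mem_iota.
  rewrite perm_rcons pU long_or_max_rcons ?cats0 // longU andbT /=.
  rewrite /good_form all_rcons pairwise_rcons gU prU !andbT /= {1}/good_cycle /= leqnn /=.
  (* The added letter [n] exceeds all earlier heads, so it crosses nothing. *)
  apply/allP => c cU; have /= cn := allP (head_flatten gU Un) c cU.
  by rewrite /noncrossing_pair /= cn.
Qed.

(** * The merging bijection *)

Lemma flatten_merge (T : eqType) (U1 U2 : seq (seq T)) h g t l :
  perm_eq (flatten (U1 ++ U2 ++ [:: (h :: g) ++ rcons t l]))
          (flatten (rcons U1 (l :: t)) ++ flatten (rcons U2 (h :: g))).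
Proof.
rewrite !flatten_cat !flatten_rcons /= cats0 -cats1; apply/seq.permP => a.
by rewrite !count_cat /= !count_cat /=; lia.
Qed.

Lemma filter_cat_all (T : eqType) (a : pred T) s1 s2 :
  all a s1 -> all (predC a) s2 -> filter a (s1 ++ s2) = s1.
Proof.
move=> as1 as2; rewrite filter_cat (all_filterP as1).
rewrite (_ : filter a s2 = [::]) ?cats0 //.
by apply/eqP; rewrite -[_ == _]negbK -has_filter -all_predC.
Qed.

(** Filtering by the threshold [l] separates the pieces, so each must exhaust its own interval. *)
Lemma perm_cat_iota s1 s2 l n : l <= n -> all (gtn l) s1 -> all (leq l) s2 ->
  perm_eq (s1 ++ s2) (iota 0 n)
  = perm_eq s1 (iota 0 l) && perm_eq s2 (iota l (n - l)).
Proof.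
move=> ln s1l s2l; rewrite -{1}(subnKC ln) iotaD add0n.
apply/idP/andP => [p12|[p1 p2]]; last exact: perm_cat.
suff p1 : perm_eq s1 (iota 0 l).
  by split=> //; rewrite -(perm_cat2l s1) (perm_trans p12) // perm_cat2r perm_sym.
have := perm_filter (gtn l) p12; rewrite !filter_cat_all //.
- by apply/allP => x; rewrite mem_iota.
- by apply/allP => x; rewrite mem_iota /= -leqNgt => /andP[].
- by apply: sub_all s2l => x /=; rewrite -leqNgt.
Qed.

(** The [[::]] given to [belast] is a dummy first entry, which [behead] removes again. *)
Definition drop_last (cs : seq (seq nat)) := behead (belast [::] cs).

(* Merges (l S) with the shifted (N G) into (N G S l), where l = k - 1. *)
Definition merge_forms k (cs1 cs2 : seq (seq nat)) : seq (seq nat) :=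
  let cs2k := map (map (addn k)) cs2 in
  drop_last cs1 ++ drop_last cs2k
    ++ [:: last [::] cs2k ++ rcons (behead (last [::] cs1)) k.-1].

Lemma merge_formsE k U1 l t cs2 U2 h g :
    map (map (addn k)) cs2 = rcons U2 (h :: g) ->
  merge_forms k (rcons U1 (l :: t)) cs2
  = U1 ++ U2 ++ [:: (h :: g) ++ rcons t k.-1].
Proof. by rewrite /merge_forms /drop_last => ->; rewrite !belast_rcons !last_rcons. Qed.

Lemma long_or_max_shift k m cs : cs \in forms m.+1 (long_or_max m.+1) ->
  exists U g, [/\ map (map (addn k)) cs = rcons U (k + m :: g),
    all (leq k) (flatten U ++ k + m :: g) & long_cycles U].
Proof.
case/long_or_max_last=> U [v [-> _ longU]].
exists (map (map (addn k)) U), (map (addn k) v).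
rewrite map_rcons all_cat -map_flatten /= all_map leq_addr all_map.
split=> //; last first.
  by rewrite /long_cycles all_map; apply: sub_all longU => c /=; rewrite size_map.
by apply/and3P; split=> //; apply/allP => x _ /=; rewrite leq_addr.
Qed.

Lemma flatten_shift k n cs :
  perm_eq (flatten (map (map (addn k)) cs)) (iota k n)
  = perm_eq (flatten cs) (iota 0 n).
Proof.
rewrite -map_flatten -[k in iota k]addn0 iotaDl.
by apply/idP/idP => [/(perm_map_inj (@addnI k))|/(perm_map (addn k))].
Qed.

Lemma merge_forms_in n k cs1 cs2 : 0 < k <= n ->
    cs1 \in forms k (long_or_max k) ->
    cs2 \in forms (n.+1 - k) (long_or_max (n.+1 - k)) ->
  merge_forms k cs1 cs2 \in forms n.+1 long_cycles.
Proof.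
case: k => // l /= ln cs1_in cs2_in.
have [U1 [t [cs1E low long1]]] := long_or_max_last cs1_in.
(* The second piece is nonempty; a visible successor lets its largest letter be named. *)
have nl : n.+1 - l.+1 = (n - l.+1).+1 by lia.
rewrite nl in cs2_in.
have [U2 [g [cs2E high long2]]] := long_or_max_shift l.+1 cs2_in.
rewrite cs1E (merge_formsE _ _ _ cs2E) /=.
move: cs1_in cs2_in; rewrite !mem_forms cs1E -nl -(flatten_shift l.+1 _ cs2).
rewrite -(good_form_shift l.+1 cs2).
rewrite cs2E => /and3P[p1 g1 _] /and3P[p2 g2 _].
rewrite good_form_merge // g1 g2 (permPl (flatten_merge _ _ _ _ _ _)).
rewrite -(subnKC (leqW ln)) iotaD perm_cat //=.
by rewrite /long_cycles !all_cat; apply/and3P; split; rewrite //= size_cat size_rcons addnS.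
Qed.

Lemma merge_forms_onto n cs : cs \in forms n.+1 long_cycles ->
  exists k cs1 cs2, [/\ 0 < k <= n, cs1 \in forms k (long_or_max k),
    cs2 \in forms (n.+1 - k) (long_or_max (n.+1 - k)) & cs = merge_forms k cs1 cs2].
Proof.
rewrite mem_forms => /and3P[pcs gcs longcs].
have [U1 [l [t [U2 [g [csE low high]]]]]] := good_form_split gcs longcs pcs.
have ln : l < n by move: high; rewrite all_cat => /and3P[].
exists l.+1, (rcons U1 (l :: t)).
(* Truncated subtraction loses nothing, since all these letters exceed [l]. *)
pose cs2 := map (map (subn^~ l.+1)) (rcons U2 (n :: g)).
have cs2E : map (map (addn l.+1)) cs2 = rcons U2 (n :: g).
  rewrite -map_comp -[RHS]map_id; apply/eq_in_map => c cU.
  rewrite /= -map_comp -[RHS]map_id; apply/eq_in_map => x xc /=.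
  rewrite subnKC //; apply: (allP high); rewrite -flatten_rcons.
  by apply/flattenP; exists c.
have := good_form_merge low high; rewrite -csE gcs => /esym/andP[g1 g2].
move: pcs; rewrite csE (permPl (flatten_merge _ _ _ _ _ _)).
rewrite (@perm_cat_iota _ _ l.+1) ?(leqW ln) //; last 2 first.
- move: low; rewrite flatten_rcons !all_cat /= ltnSn => /andP[low1 low2].
  by apply/andP; split; [apply: sub_all low1 | apply: sub_all low2] => x /ltnW.
- by rewrite flatten_rcons.
case/andP=> p1 p2; exists cs2; rewrite (merge_formsE _ _ _ cs2E).
move: longcs; rewrite csE /long_cycles !all_cat => /and3P[long1 long2 _].
split=> //.
  rewrite mem_forms p1 g1 long_or_max_rcons //.
rewrite mem_forms -(flatten_shift l.+1) -(good_form_shift l.+1) cs2E p2 g2 /=.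
rewrite /long_or_max /cs2 all_map all_rcons; apply/andP; split.
  (* The head [n] becomes [n - l.+1], the largest letter of the second piece, so an empty [g] gives
     the permitted singleton. *)
  rewrite /= size_map; case: (g) => //=; rewrite eqseq_cons eqxx andbT; apply/eqP; lia.
by apply: sub_all long2 => c /=; rewrite size_map => ->.
Qed.

Lemma cat_split_inj (T : eqType) (a : pred T) s1 s2 t1 t2 :
    all a s1 -> all a t1 -> all (predC a) s2 -> all (predC a) t2 ->
  s1 ++ s2 = t1 ++ t2 -> s1 = t1 /\ s2 = t2.
Proof.
move=> as1 at1 as2 at2 E; have s1E : s1 = t1.
  by rewrite -(filter_cat_all as1 as2) E filter_cat_all.
split=> //; move: E; rewrite s1E => /eqP.
by rewrite eqseq_cat // eqxx => /eqP.
Qed.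

Lemma merge_forms_inj n k k' cs1 cs1' cs2 cs2' : 0 < k <= n -> 0 < k' <= n ->
    cs1 \in forms k (long_or_max k) -> cs1' \in forms k' (long_or_max k') ->
    cs2 \in forms (n.+1 - k) (long_or_max (n.+1 - k)) ->
    cs2' \in forms (n.+1 - k') (long_or_max (n.+1 - k')) ->
  merge_forms k cs1 cs2 = merge_forms k' cs1' cs2' ->
  [/\ k = k', cs1 = cs1' & cs2 = cs2'].
Proof.
case: k k' => // l [] // l' /= ln ln' cs1_in cs1_in' cs2_in cs2_in'.
have good_in m Q cs : cs \in forms m Q -> all good_cycle cs.
  by rewrite mem_forms => /and3P[_ /andP[]].
have := (good_in _ _ _ cs1_in, good_in _ _ _ cs1_in').
have := (good_in _ _ _ cs2_in, good_in _ _ _ cs2_in').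
have nl j : j < n -> n.+1 - j.+1 = (n - j.+1).+1 by lia.
rewrite nl // in cs2_in; rewrite nl // in cs2_in'.
have [U1 [t [-> low _]]] := long_or_max_last cs1_in.
have [U1' [t' [-> low' _]]] := long_or_max_last cs1_in'.
have [U2 [g [cs2E high _]]] := long_or_max_shift l.+1 cs2_in.
have [U2' [g' [cs2E' high' _]]] := long_or_max_shift l'.+1 cs2_in'.
rewrite -(eq_all (good_cycle_shift l.+1)) -(eq_all (good_cycle_shift l'.+1) cs2').
rewrite -[all _ cs2]all_map -[all _ cs2']all_map cs2E cs2E'.
rewrite !all_rcons => -[/andP[_ gU2] /andP[_ gU2']] [/andP[_ gU1] /andP[_ gU1']].
rewrite (merge_formsE _ _ _ cs2E) (merge_formsE _ _ _ cs2E') /= !catA !cats1.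
move/eqP; rewrite eqseq_rcons => /andP[/eqP EU /eqP EM].
(* The merged cycle ends in [k - 1], so [k] is recovered first. *)
move: EM; rewrite -!cat_cons -!rcons_cat => /eqP; rewrite eqseq_rcons.
move=> /andP[/eqP EM /eqP ll']; subst l'.
move: low low' high high'; rewrite !all_cat.
move=> /andP[lU1 lt] /andP[lU1' lt'] /andP[hU2 hg] /andP[hU2' hg'].
have notlt x : x < l -> ~~ (l < x) by rewrite -leqNgt; apply: ltnW.
have notgt x : l < x -> ~~ (x < l) by rewrite -leqNgt; apply: ltnW.
(* With [l] known, comparison with [l] separates the two parts of the merged cycle, and comparing
   heads with [l] separates the other cycles. *)
have [Eg Et] := cat_split_inj hg hg' (sub_all notlt lt) (sub_all notlt lt') EM.
have [] := cat_split_inj (head_flatten gU1 lU1) (head_flatten gU1' lU1')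
  (sub_all (fun c => notgt (head 0 c)) (head_flatten gU2 hU2))
  (sub_all (fun c => notgt (head 0 c)) (head_flatten gU2' hU2')) EU.
move=> -> EU2; split=> //; first by rewrite Et.
apply: (inj_map (inj_map (@addnI l.+1))).
by rewrite cs2E cs2E' EU2 Eg.
Qed.

(** * The recurrence *)

(** Merging is a bijection from the triples (k, cs1, cs2); neither piece is empty, so [k] runs from
    1 to [n]. *)
Lemma size_long_cycles n :
  size (forms n.+1 long_cycles)
  = \sum_(1 <= k < n.+1) size (forms k (long_or_max k))
                       * size (forms (n.+1 - k) (long_or_max (n.+1 - k))).
Proof.
pose pairs k := [seq (cs1, cs2) | cs1 <- forms k (long_or_max k),
                                  cs2 <- forms (n.+1 - k) (long_or_max (n.+1 - k))].
pose triples := [seq (k, cs) | k <- index_iota 1 n.+1, cs <- pairs k].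
have triplesP k cs1 cs2 : reflect [/\ 0 < k <= n, cs1 \in forms k (long_or_max k)
    & cs2 \in forms (n.+1 - k) (long_or_max (n.+1 - k))] ((k, (cs1, cs2)) \in triples).
  apply: (iffP allpairsPdep) => [[j [[c1 c2] [jn /allpairsP[[b1 b2] [] /= ? ?]]]]|].
    by case=> -> -> [-> -> ->]; rewrite mem_index_iota in jn.
  case=> kn c1 c2; exists k, (cs1, cs2); rewrite mem_index_iota; split=> //.
  by apply/allpairsP; exists (cs1, cs2).
have uniq_triples : uniq triples.
  apply: allpairs_uniq_dep; rewrite ?iota_uniq //.
    move=> k _; apply: allpairs_uniq; rewrite ?forms_uniq //.
    by move=> [? ?] [? ?] _ _ [-> ->].
  by move=> [? ?] [? ?] _ _ /= [-> ->].
rewrite (_ : \sum_(_ <= _ < _) _ = size triples); last first.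
  rewrite size_allpairs_dep sumnE big_map; apply: eq_bigr => k _.
  by rewrite size_allpairs.
rewrite -(size_map (fun q => merge_forms q.1 q.2.1 q.2.2)).
apply/perm_size/uniq_perm; rewrite ?forms_uniq //.
  rewrite map_inj_in_uniq // => -[k [c1 c2]] [k' [c1' c2']].
  case/triplesP=> kn in1 in2 /triplesP[kn' in1' in2'] /= E.
  by have [-> -> ->] := merge_forms_inj kn kn' in1 in1' in2 in2' E.
move=> cs; apply/idP/mapP => [|[[k [c1 c2]] /triplesP[kn in1 in2] ->]].
  case/merge_forms_onto=> k [c1 [c2 [kn in1 in2 csE]]].
  by exists (k, (c1, c2)) => //; apply/triplesP.
exact: merge_forms_in.
Qed.

Theorem theorem6p2 (n : nat) (hn : 1 <= n) :
  num_avoiders n =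
  \sum_(1 <= k < n) (num_avoiders k + num_avoiders (k - 1))
                    * (num_avoiders (n - k) + num_avoiders (n - k - 1)).
Proof.
case: n hn => // n _; rewrite num_avoiders_forms size_long_cycles.
apply: eq_big_nat => k /andP[k_gt0 kn].
(* Both sizes are positive, so each factor splits by whether the largest letter is fixed. *)
have lomE m : 0 < m ->
    size (forms m (long_or_max m)) = num_avoiders m + num_avoiders (m - 1).
  by case: m => // m _; rewrite size_long_or_max subn1 !num_avoiders_forms.
by rewrite !lomE // subn_gt0.
Qed.
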